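(* For any value maximizer with a continuous valuation distribution $F$ and a private return-on-spend target $\gamma\ge 1$, there exists a corresponding standard utility maximizer drawing its valuation from a regular distribution $G$ such that, under any anonymous price $p>0$, both agents have identical purchasing probabilities and generate exactly the same expected revenue. That is, $\Pr_{z\sim G}[z\ge p]=\Pr_{v\sim F}[v\ge\tau(p)]$ for every $p>0$, where $\tau(p)$ is the value maximizer's acceptance threshold at price $p$ (and hence $p\cdot\Pr_{z\sim G}[z\ge p]=p\cdot\Pr_{v\sim F}[v\ge\tau(p)]$).
   Context: Valuations are drawn from a continuous CDF with a well-defined density on a non-negative support. Value maximizer. Facing a posted price $p$, a value maximizer with valuation $v\sim F$ and return-on-spend (ROS) target $\gamma\ge1$ maximizes the expected value acquired subject to the ROS constraint that expected acquired value is at least $\gamma$ times expected payment. Its behavior is a threshold rule: it buys at price $p$ iff $v\ge\tau(p)$, where $$\tau(p)=\inf\{\tau\in\mathrm{supp}(F):\ \mathbb{E}_{v\sim F}[v\mid v\ge\tau]\ge\gamma p\},$$ with $\tau(p)=\infty$ (never buys) if the set is empty. Its expected revenue at price $p$ is $p\cdot\Pr[v\ge\tau(p)]$. Standard utility maximizer. With valuation $z\sim G$, it buys at price $p$ iff $z\ge p$; its expected revenue at price $p$ is $p\cdot\Pr[z\ge p]$. Regularity. A distribution $G$ with density $g$ is regular if its virtual valuation $z-\frac{1-G(z)}{g(z)}$ is non-decreasing, equivalently, its quantile revenue curve $q\mapsto q\,G^{-1}(1-q)$ is concave.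
   Formalization: The valuation distribution F is additionally assumed to have finite mean; if its mean is infinite, the value maximizer buys at every price with probability 1, and no real-valued G can match this. *)

(* Defs.v *)
From mathcomp Require Export all_boot all_order all_algebra.
From mathcomp Require Export all_classical all_reals all_analysis.
Export Order.TTheory GRing.Theory Num.Theory.
Export numFieldNormedType.Exports.

Set Implicit Arguments.
Unset Strict Implicit.
Unset Printing Implicit Defensive.

Local Open Scope classical_set_scope.
Local Open Scope ring_scope.
Local Open Scope ereal_scope.

Notation law R := (probability (measurableTypeR R) R).

Section Distributions.
Variable R : realType.
Implicit Types (F : law R) (f : R -> R) (x : R).

Definition law_cdf F x : \bar R := F `]-oo, x]%classic.

Definition law_support F : set R :=
  [set x | forall e : R, (0 < e)%R -> 0 < F (ball x e)].

Definition has_density F f : Prop :=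
  [/\ measurable_fun setT f, (forall x, (0 <= f x)%R) &
      forall A : set R, measurable A ->
        F A = \int[lebesgue_measure]_(x in A) (f x)%:E].

Definition valuation_law F f : Prop :=
  [/\ continuous (law_cdf F), has_density F f &
      law_support F `<=` [set x | (0 <= x)%R]].

(* In [\bar R], [r / 0 = +oo] for [r > 0] and [0 / 0 = 0].  So the virtual
   value is [-oo] where the density vanishes and mass remains above [x], and it
   is [x] where no mass remains above [x]. *)
Definition virtual_value F f x : \bar R :=
  x%:E - (1 - law_cdf F x) / (f x)%:E.

(* Monotonicity is required on all of [R].  With the conventions above, points
   below or above the support impose no constraint beyond choosing the density
   to be 0 below the support, whereas a gap inside the support violates
   monotonicity, as it violates concavity of the revenue curve. *)
Definition regular F f : Prop :=
  {homo virtual_value F f : x y / (x <= y)%R >-> x <= y}.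

End Distributions.

Section ValueMaximizer.
Variables (R : realType) (F : law R) (gamma : R).

(* When [F [set v | tau <= v]] is 0 this is [0 / 0 = 0], so such a [tau] never
   meets the return-on-spend constraint at a positive price. *)
Definition mean_above (tau : R) : \bar R :=
  (\int[F]_(v in [set v : R | (tau <= v)%R]) v%:E) /
  F [set v : R | (tau <= v)%R].

(* [ereal_inf set0 = +oo]: the agent never buys. *)
Definition threshold (p : R) : \bar R :=
  ereal_inf [set tau%:E | tau in
    [set tau | law_support F tau /\ (gamma * p)%:E <= mean_above tau]].

Definition vm_purchase_prob (p : R) : \bar R :=
  F [set v : R | threshold p <= v%:E].

Definition vm_revenue (p : R) : \bar R := p%:E * vm_purchase_prob p.

End ValueMaximizer.

Section UtilityMaximizer.
Variables (R : realType) (G : law R).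

Definition um_purchase_prob (p : R) : \bar R := G [set z : R | (p <= z)%R].

Definition um_revenue (p : R) : \bar R := p%:E * um_purchase_prob p.

End UtilityMaximizer.

(* Main.v *)
(* Let [z v = E[x | x >= v] / gamma]. Up to a null set, the value maximizer buys
   at price [p] exactly when [p <= z v], so the law [G] of [z v] has the
     required
   purchase probabilities. At price [z t] the revenue is [E[v; v >= t] / gamma],
   whose marginal revenue, the virtual value of [G], is [t / gamma]:
     it increases
   with the price. Writing [Q p] for [G [p, +oo[] and [phi] for this virtual
   value, integrating the revenue identity gives the equality of measures
   [Q dp = (p - phi p) dG] above the least price [E[v] / gamma], and dividing by
   [p - phi p > 0] gives the density [Q p / (p - phi p)] of [G]. *)

Require Import Defs.
From HB Require Import structures.
From mathcomp Require Import measurable_realfun ring lra.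
Set Implicit Arguments.
Unset Strict Implicit.
Unset Printing Implicit Defensive.

Local Open Scope classical_set_scope.
Local Open Scope ring_scope.

(** The revenue identity is integrated instead by evaluating [E[min (z v) d]] twice. The layer-cake
    formula gives [z 0] plus the integral of [Q] from [z 0] to [d]. Splitting at [z v = d], the
    upper part is [d * Q d = E[v; z v >= d] / gamma] and the lower part is [E[v; z v <= d] / gamma]
    plus [E[z v - v / gamma; z v <= d]]; the terms in [v] add up to [E[v] / gamma = z 0]. Comparison
    yields the equality of measures on half-lines, which determine a measure. A gap of [F] does not
    become a gap of [G], which regularity would forbid: tail probability and tail integral are both
    constant on it, so the gap collapses to a single price, where the virtual value jumps upward. *)

(* [S] and [M] abstract the tail probability [v |-> Pr[x >= v]] and the tail
   integral [v |-> E[x; x >= v]]; every later comparison of conditional means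
   [M v / S v] is cross-multiplied. *)
Record tail_pair (R : realType) (S M : R -> R) : Prop := TailPair {
  tp_cont : continuous S;
  tp_ge0 : forall v, 0 <= S v;
  tp_le1 : forall v, S v <= 1;
  tp_anti : forall a b, a <= b -> S b <= S a;
  tp_lb : forall a b, a <= b -> a * (S a - S b) <= M a - M b;
  tp_ub : forall a b, a <= b -> M a - M b <= b * (S a - S b);
  tp_ge : forall b, b * S b <= M b;
  tp_at0 : S 0 = 1
}.

(** * Monotonicity, continuity and inversion of the conditional mean *)

Section Tail.
Variables (R : realType) (S M : R -> R).
Hypothesis SM : tail_pair S M.

Let S_cont := tp_cont SM.
Let S_ge0 := tp_ge0 SM.
Let S_le1 := tp_le1 SM.
Let S_anti := tp_anti SM.
Let SM_lb := tp_lb SM.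
Let SM_ub := tp_ub SM.
Let M_lb := tp_ge SM.
Let S0 := tp_at0 SM.

Lemma tail_gt0_right t : 0 < S t -> exists2 u, t < u & 0 < S u.
Proof.
move=> St.
have : \forall x \near t, 0 < S x.
  by have /cvgr_gt := tp_cont SM (x:=t); apply.
case => e /= e0 He; exists (t + e / 2); first by rewrite ltrDl divr_gt0.
apply: He; rewrite /= opprD addNKr normrN gtr0_norm ?divr_gt0//.
by rewrite ltr_pdivrMr// ltr_pMr// ltr1n.
Qed.

(** Continuity of [S] leaves mass beyond some [u > t], and this mass contributes an excess of at
    least [(u - t) * S u]. *)
Lemma tail_mean_gt t : 0 < S t -> t * S t < M t.
Proof.
move=> /tail_gt0_right[u tu Su].
have := SM_lb (ltW tu); have := M_lb u.
have : 0 < (u - t) * S u by rewrite mulr_gt0// subr_gt0.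
lra.
Qed.

(** Raising the cutoff from [a] to [b] discards mass of mean at most [b], hence at most the mean of
    what remains. *)
Lemma tail_mean_le a b : a <= b -> M a * S b <= M b * S a.
Proof.
move=> ab; have h1 := SM_ub ab; have h2 := M_lb b; have h3 := S_anti ab.
have h4 := S_ge0 b.
have : (M a - M b) * S b <= b * (S a - S b) * S b by exact: ler_wpM2r.
have : (b * S b) * (S a - S b) <= M b * (S a - S b).
  by apply: ler_wpM2r => //; rewrite subr_ge0.
lra.
Qed.

Lemma tail_mean_lt a b : a <= b -> 0 < S b -> S b < S a ->
  M a * S b < M b * S a.
Proof.
move=> ab Sb Sab; have h1 := SM_ub ab; have h2 := tail_mean_gt Sb.
have : (M a - M b) * S b <= b * (S a - S b) * S b by apply: ler_wpM2r => //;
  exact: ltW.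
have : (b * S b) * (S a - S b) < M b * (S a - S b).
  by rewrite ltr_pM2r// subr_gt0.
lra.
Qed.

(** Near [a], increments of [M] are at most [|a| + 1] times those of [S], so continuity passes from
    [S] to [M]. *)
Lemma tail_integral_cont : continuous M.
Proof.
move=> a.
have dSM b : `|b - a| <= 1 -> `|M b - M a| <= (`|a| + 1) * `|S b - S a|.
  move=> ba.
  have hb : `|b| <= `|a| + 1.
    by rewrite -(subrK a b) (le_trans (ler_normD _ _))// addrC lerD2l.
  have ha : `|a| <= `|a| + 1 by rewrite lerDl.
  have aux (x y : R) : x <= y -> `|x| <= `|a| + 1 -> `|y| <= `|a| + 1 ->
      `|M x - M y| <= (`|a| + 1) * `|S x - S y|.
    move=> xy hx hy; have h0 := S_anti xy.
    rewrite [`|S x - S y|]ger0_norm ?subr_ge0// ler_norml.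
    have d0 : 0 <= S x - S y by rewrite subr_ge0.
    rewrite (le_trans _ (SM_lb xy)) ?(le_trans (SM_ub xy))//=.
      by apply: ler_wpM2r => //; exact: le_trans (ler_norm _) hy.
    rewrite -mulNr; apply: ler_wpM2r => //.
    by move: hx; rewrite ler_norml => /andP[].
  have [|/ltW] := leP a b => ab; last exact: aux.
  by rewrite distrC (distrC (S b)); exact: aux.
apply/cvgrPdist_le => e e0.
have a1 : 0 < `|a| + 1 by rewrite ltr_wpDl.
near=> b.
have -> : `|M a - M b| = `|M b - M a| by rewrite distrC.
apply: (le_trans (dSM b _)).
  rewrite distrC; near: b.
  by have /cvgrPdist_le/(_ 1 ltr01) : b @[b --> a] --> a by exact: cvg_id.
rewrite mulrC -ler_pdivlMr// distrC; near: b.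
by move/cvgrPdist_le : (S_cont (x:=a)); apply; rewrite divr_gt0.
Unshelve. all: by end_near. Qed.

Definition below_mean (x : R) : set R := [set t | 0 < S t /\ M t <= x * S t].

(** A generalized inverse of the conditional mean [M t / S t]; on a flat piece it selects the right
    end. *)
Definition mean_inv (x : R) : R := sup (below_mean x).

(** Bounds [below_mean x] above, so that [mean_inv x] is a genuine supremum and not the default
    value of [sup]. *)
Definition mean_exceeds (x : R) := exists2 v, 0 < S v & x * S v < M v.

Lemma below_mean0 x : M 0 <= x -> below_mean x 0.
Proof. by move=> Mx; rewrite /below_mean/= S0 mulr1. Qed.

Lemma below_mean_ub x v : 0 < S v -> x * S v < M v -> ubound (below_mean x) v.
Proof.
move=> Sv xv t [St Mt]; rewrite leNgt; apply/negP => /ltW vt.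
have := tail_mean_le vt; rewrite leNgt => /negP; apply.
apply: (@le_lt_trans _ _ (x * S t * S v)); first by apply: ler_wpM2r => //;
  exact: ltW.
by rewrite mulrAC ltr_pM2r.
Qed.

Lemma has_sup_below_mean x : M 0 <= x -> mean_exceeds x ->
  has_sup (below_mean x).
Proof.
move=> Mx [v Sv xv]; split; first by exists 0; exact: below_mean0.
by exists v; exact: below_mean_ub.
Qed.

Lemma mean_inv_le x y : M 0 <= x -> mean_exceeds y -> x <= y ->
  mean_inv x <= mean_inv y.
Proof.
move=> Mx ey xy; apply: le_sup.
- move=> t [St Mt]; exists t; split => //; split => //.
  by rewrite (le_trans Mt)// ler_wpM2r// ltW.
- by exists 0; exact: below_mean0.
- by apply: has_sup_below_mean => //; exact: le_trans xy.
Qed.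

(* If [mean_inv x >= x], a near-maximal [t] and a point [u] of positive tail
   above the supremum give [M t > x * S t]. *)
Lemma mean_inv_lt x : M 0 <= x -> mean_exceeds x -> mean_inv x < x.
Proof.
move=> Mx ex; have hs := has_sup_below_mean Mx ex.
case: ex => v Sv xv; have [u vu Su] := tail_gt0_right Sv.
have Tv : mean_inv x <= v by apply: ge_sup; [case: hs | exact: below_mean_ub].
have Tu : mean_inv x < u by exact: le_lt_trans vu.
rewrite ltNge; apply/negP => xT.
(* This is the excess carried by the mass beyond [u]. Replacing [mean_inv x] by a smaller [t] loses
   at most [mean_inv x - t], because [S t - S u <= 1]. *)
have d0 : 0 < (u - mean_inv x) * S u by rewrite mulr_gt0// subr_gt0.
have [t [St Mt] Tt] := sup_adherent d0 hs.
rewrite -/(mean_inv x) in Tt.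
have tT : t <= mean_inv x by apply: ub_le_sup => //; case: hs.
have tu : t <= u by apply: le_trans tT (ltW Tu).
have h1 := SM_lb tu; have h2 := M_lb u; have h3 := S_anti tu.
have h4 := S_le1 t; have h5 := S_ge0 u.
have : 0 <= (mean_inv x - t) * (1 - (S t - S u)).
  by rewrite mulr_ge0 ?subr_ge0//; lra.
have : x * S t <= mean_inv x * S t by rewrite ler_wpM2r.
lra.
Qed.

(** The intermediate value theorem applied to [M t - x * S t]: nonpositive at 0 because [S 0 = 1],
    positive at the witness of [mean_exceeds]. *)
Lemma mean_root x : M 0 <= x -> mean_exceeds x ->
  exists2 t, 0 < S t & M t = x * S t.
Proof.
move=> Mx ex; have [v Sv xv] := ex.
have v0 : 0 <= v by apply: (below_mean_ub Sv xv); exact: below_mean0.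
have := @IVT R (fun t => M t - x * S t) 0 v 0 v0.
case.
- apply: continuous_subspaceT => t; apply: cvgB;
    first exact: tail_integral_cont.
  by apply: cvgM; [exact: cvg_cst | exact: S_cont].
- by rewrite S0 mulr1 ge_min le_max !subr_ge0 subr_le0 Mx (ltW xv) orbT.
move=> t; rewrite in_itv/= => /andP[_ tv] /eqP; rewrite subr_eq0 => /eqP Mt.
by exists t => //; exact: lt_le_trans (S_anti tv).
Qed.

End Tail.

(** * Comparison up to null sets, and measurability of inverses *)

Lemma ae_measure_le d (T : measurableType d) (R : realType)
    (mu : {measure set T -> \bar R}) (A B : set T) :
  measurable A -> measurable B -> {ae mu, forall x, A x -> B x} ->
  (mu A <= mu B)%E.
Proof.
move=> mA mB [N [mN N0 ABN]].
have /le_trans -> // : (mu A <= mu (B `|` N))%E.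
  apply: le_measure; rewrite ?inE//; first exact: measurableU.
  move=> x Ax; have [Nx|/(contra_not (@ABN x))/contrapT AB] := pselect (N x).
    by right.
  by left; exact: AB.
by rewrite (le_trans (measureU2 _ _ _))//= N0 adde0.
Qed.

Lemma ae_measure_eq d (T : measurableType d) (R : realType)
    (mu : {measure set T -> \bar R}) (A B : set T) :
  measurable A -> measurable B -> {ae mu, forall x, A x <-> B x} -> mu A = mu B.
Proof.
move=> mA mB AB; apply/eqP; rewrite eq_le !ae_measure_le//.
  by apply: filterS AB => x [].
by apply: filterS AB => x [].
Qed.

Lemma ae_integral_set d (T : measurableType d) (R : realType)
    (mu : {measure set T -> \bar R}) (A B : set T) (h : T -> \bar R) :
  measurable A -> measurable B -> measurable_fun setT h ->
  {ae mu, forall x, A x <-> B x} ->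
  (\int[mu]_(x in A) h x = \int[mu]_(x in B) h x)%E.
Proof.
move=> mA mB mh AB; rewrite integral_mkcond [RHS]integral_mkcond.
apply: ae_eq_integral => //.
- by apply/(measurable_restrictT _ _).1 => //; exact: measurable_funTS.
- by apply/(measurable_restrictT _ _).1 => //; exact: measurable_funTS.
- apply: filterS AB => x ABx _; rewrite !patchE.
  by congr (if _ then _ else _); apply/idP/idP; rewrite !inE => /ABx.
Qed.

Lemma measurable_funV (R : realType) d (T : measurableType d) (h : T -> R) :
  (forall x, 0 <= h x) -> measurable_fun setT h ->
  measurable_fun setT (fun x => (h x)^-1).
Proof.
move=> h0 mh; rewrite (_ : (fun x => _) = (fun x => h x `^ (-1))).
  exact: measurableT_comp (measurable_powR _) mh.
by apply/funext => x; rewrite powR_inv1.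
Qed.

(** * Measures with a density *)

Section Density.
Local Open Scope ereal_scope.
Context d (T : measurableType d) (R : realType).
Variables (mu : {measure set T -> \bar R}) (f : T -> R).
Hypotheses (f_ge0 : forall x, (0 <= f x)%R) (mf : measurable_fun setT f).

Let mfE : measurable_fun setT (EFin \o f).
Proof. exact/measurable_EFinP. Qed.

(** Turns an indefinite integral into a measure, to which uniqueness theorems and integration
    apply. *)
Lemma density_measure : exists nu : {measure set T -> \bar R},
  forall A, nu A = \int[mu]_(x in A) (f x)%:E.
Proof.
pose nu A := \int[mu]_(x in A) (f x)%:E.
have nu0 : nu set0 = 0 by exact: integral_set0.
have nu_ge0 A : 0 <= nu A by apply: integral_ge0 => x _; rewrite lee_fin f_ge0.
have nu_sigma : semi_sigma_additive nu.
  move=> B mB tB mUB; rewrite /nu ge0_integral_bigcup//.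
  - by apply: is_cvg_nneseries_cond => n _ _; exact: nu_ge0.
  - exact: measurable_funTS.
  - by move=> x _; rewrite lee_fin.
pose nuM : {measure set T -> \bar R} :=
  HB.pack nu (isMeasure.Build d T R nu nu0 nu_ge0 nu_sigma).
by exists nuM.
Qed.

Import HBNNSimple.

(** Scaled indicators ([piece]), then simple functions by finite sums, then monotone convergence. It
    is used to divide the equality of measures by [weight]. *)
Lemma ge0_integral_density (nu : {measure set T -> \bar R}) (k : T ->
  \bar R) A :
  (forall B, measurable B -> nu B = \int[mu]_(x in B) (f x)%:E) ->
  (forall x, 0 <= k x) -> measurable_fun setT k -> measurable A ->
  \int[nu]_(x in A) k x = \int[mu]_(x in A) ((f x)%:E * k x).
Proof.
move=> nuE k_ge0 mk mA; have mkA := measurable_funTS mk : measurable_fun A k.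
pose h := nnsfun_approx mA mkA.
have hk x : A x -> (h n x)%:E @[n --> \oo] --> k x.
  by move=> Ax; exact: (@cvg_nnsfun_approx _ _ _ _ mA k mkA).
have h_nd x : {homo (fun n => (h n x)%:E) : m n / (m <= n)%N >-> m <= n}.
  by move=> m n mn; rewrite lee_fin; exact/lefP/nd_nnsfun_approx.
have mh n : measurable_fun A (EFin \o h n) by apply: measurable_funTS;
  exact/measurable_EFinP.
have simple n : \int[nu]_(x in A) (h n x)%:E =
  \int[mu]_(x in A) ((f x)%:E * (h n x)%:E).
  have piece y : (0 <= y)%R -> \int[nu]_(x in A) (y * \1_(h n @^-1` [set y])
    x)%:E =
      \int[mu]_(x in A) ((f x)%:E * (y * \1_(h n @^-1` [set y]) x)%:E).
    move=> y0; set E := h n @^-1` [set y];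
      have mE : measurable E by exact: measurable_funPTI.
    under eq_integral do rewrite EFinM.
    under [RHS]eq_integral do rewrite EFinM muleCA.
    have mEA : measurable_fun A (fun x => (\1_E x : R)%:E).
      by apply/measurable_EFinP; exact: measurable_indic.
    rewrite !ge0_integralZl//; last 2 first.
    + by apply: emeasurable_funM => //; exact: measurable_funTS.
    + by move=> x _; rewrite mule_ge0 ?lee_fin.
    rewrite integral_indic// setIC nuE; last exact: measurableI.
    by rewrite integral_mkcondr epatch_indic.
  transitivity (\int[nu]_(x in A)
      (\sum_(y \in range (h n)) (y * \1_(h n @^-1` [set y]) x)%:E)).
    by apply: eq_integral => x _; rewrite fimfunE -fsumEFin.
  have m1 y : measurable_fun A (fun x => (y * \1_(h n @^-1` [set y]) x)%:E).
    apply/measurable_EFinP; apply: measurable_funM => //;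
      apply: measurable_indic.
  rewrite ge0_integral_fsum//; last by move=> y x _; exact: nnfun_muleindic_ge0.
  transitivity (\int[mu]_(x in A)
      (\sum_(y \in range (h n)) (f x)%:E * (y * \1_(h n @^-1` [set y]) x)%:E));
        last first.
    apply: eq_integral => x _; rewrite -ge0_mule_fsumr; last by move=> y;
      exact: nnfun_muleindic_ge0.
    by rewrite fsumEFin// -fimfunE.
  rewrite ge0_integral_fsum//; last 2 first.
  - by move=> y; apply: emeasurable_funM => //; exact: measurable_funTS.
  - by move=> y x _; apply: mule_ge0;
      [rewrite lee_fin | exact: nnfun_muleindic_ge0].
  by apply: eq_fsbigr => y; rewrite inE => -[x _ <-]; rewrite piece.
transitivity (limn (fun n => \int[nu]_(x in A) (h n x)%:E)).
  rewrite -monotone_convergence//.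
  - apply: eq_integral => x; rewrite inE => Ax; apply/esym/cvg_lim => //;
      exact: hk.
  - by move=> n x _; rewrite lee_fin.
transitivity (limn (fun n => \int[mu]_(x in A) ((f x)%:E * (h n x)%:E))).
  by congr (limn _); apply/funext => n.
rewrite -monotone_convergence//.
- apply: eq_integral => x; rewrite inE => Ax; apply/cvg_lim => //.
  by apply: cvgeZl => //; exact: hk.
- by move=> n; apply: emeasurable_funM; [exact: measurable_funTS | exact: mh].
- by move=> n x _; rewrite mule_ge0 ?lee_fin.
- by move=> x _ m n mn; apply: lee_wpmul2l; [rewrite lee_fin | exact: h_nd].
Qed.

End Density.

(** Open left half-lines are stable under intersection, generate the Borel sets and exhaust the line
    along the integers. *)
Lemma measure_unique_halflines (R : realType)
    (m1 m2 : {measure set (measurableTypeR R) -> \bar R}) :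
  (forall x : R, m1 `]-oo, x[%classic = m2 `]-oo, x[%classic) ->
  (forall x : R, (m1 `]-oo, x[%classic < +oo)%E) ->
  forall A, measurable A -> m1 A = m2 A.
Proof.
move=> m12 m1oo A mA.
apply: (@measure_unique _ _ (measurableTypeR R) (@RGenInftyO.G R) (fun n =>
  `]-oo, n%:R[%classic)) => //.
- exact: RGenInftyO.measurableE.
- move=> _ _ [x ->] [y ->]; exists (Num.min x y).
  by apply/seteqP; split => v; rewrite /= !in_itv/= lt_min => /andP.
- by move=> n; exists n%:R.
- rewrite -subTset => x _; exists (Num.truncn `|x|).+1 => //=.
  by rewrite in_itv/= (le_lt_trans (ler_norm _))// truncnS_gt.
- by move=> _ [x ->].
Qed.

(** The closed intervals [B n] shrink to [x], so their mass tends to 0; it bounds the variation of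
    the CDF inside them. *)
Lemma atomless_cdf_continuous (R : realType) (G : law R) :
  (forall x : R, G [set x] = 0%E) -> continuous (law_cdf G).
Proof.
move=> G0 x.
have cE y : law_cdf G y = (fine (law_cdf G y))%:E
  by rewrite fineK// fin_num_measure.
rewrite (_ : law_cdf G = EFin \o (fine \o law_cdf G)); last exact/funext.
rewrite /=; apply: cvg_EFin; first by near=> y.
apply/cvgrPdist_le => e e0.
pose B n : set R := `[x - n.+1%:R^-1, x + n.+1%:R^-1]%classic.
have BI : \bigcap_n B n = [set x].
  apply/seteqP; split => [y By|_ -> n _]; last first.
    by rewrite /B/= in_itv/= lerBlDr lerDl invr_ge0 ler0n.
  have yx k : x - k.+1%:R^-1 <= y <= x + k.+1%:R^-1.
    by have := By k I; rewrite /B/= in_itv.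
  apply/eqP; rewrite eq_le; apply/andP; split; rewrite leNgt; apply/negP.
    by move=> /ltr_add_invr[k]; rewrite ltNge; case/andP: (yx k) => _ ->.
  by move=> /ltr_add_invr[k]; rewrite ltNge -lerBlDr; case/andP: (yx k) => ->.
have mB n : measurable (B n) by exact: measurable_itv.
have Bcvg : fine (G (B n)) @[n --> \oo] --> 0.
  apply: fine_cvg; have -> : 0%:E = G (\bigcap_n B n) by rewrite BI; apply/esym;
    exact: G0.
  apply: nonincreasing_cvg_mu => //.
  - apply: (@le_lt_trans _ _ 1%E); last exact: ltry.
    exact: (probability_le1 G (mB 0%N)).
  - exact: bigcapT_measurable.
  - move=> m n mn; apply/subsetPset; apply: subset_itv;
      by rewrite bnd_simp ?lerD2l ?lerN2 lef_pV2 ?posrE ?ltr0n// ler_nat ltnS.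
have /cvgrPdist_le/(_ e e0)[n _ /(_ n (leqnn n))] := Bcvg.
rewrite /= sub0r normrN ger0_norm ?fine_ge0// => Bn.
near=> y.
have xy : `|x - y| <= n.+1%:R^-1.
  near: y; have /cvgrPdist_le : y @[y --> x] --> x by exact: cvg_id.
  by apply; rewrite invr_gt0 ltr0n.
have step (a b : R) : a <= b -> B n a -> B n b ->
    `|fine (law_cdf G a) - fine (law_cdf G b)| <= e.
  move=> ab; rewrite /B/= !in_itv/= => /andP[xa _] /andP[_ bx].
  have -> : law_cdf G b = (law_cdf G a + G `]a, b]%classic)%E.
    rewrite /law_cdf -(measureU G)//; last first.
      rewrite -subset0 => v /=; rewrite !in_itv/= => -[va /andP[av _]].
      by move: (lt_le_trans av va); rewrite ltxx.
    by congr (G _); apply: itv_bndbnd_setU; rewrite bnd_simp.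
  rewrite fineD ?fin_num_measure// opprD addNKr normrN ger0_norm ?fine_ge0//.
  have abB : (G `]a, b]%classic <= G (B n))%E.
    apply: le_measure; [by rewrite inE|by rewrite inE; exact: mB|move=> v];
      rewrite /B/= !in_itv/= => /andP[av vb].
    by rewrite (le_trans xa (ltW av)) (le_trans vb bx).
  have finG (A : set (measurableTypeR R)) : measurable A -> G A \is a fin_num.
    by move=> mA; rewrite fin_num_measure.
  apply: le_trans Bn; apply: fine_le => //; last exact: (finG _ (mB n)).
  by apply: finG.
have xB : B n x by rewrite /B/= in_itv/= lerDl lerBlDr lerDl invr_ge0 ler0n.
have yB : B n y.
  by rewrite /B/= in_itv/= -ler_distl distrC.
have [xy'|/ltW yx] := leP x y; first exact: step.
by rewrite distrC; exact: step.
Unshelve. all: by end_near. Qed.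

(** * Tails of the valuation law *)

Section Transform.
Variables (R : realType) (F : law R) (gamma : R).
Hypothesis F_cont : continuous (law_cdf F).
Hypothesis F_atomless : forall x : R, F [set x] = 0%E.
Hypothesis F_nneg : law_support F `<=` [set x | 0 <= x].
Hypothesis F_int : F.-integrable setT (EFin : R -> \bar R).
Hypothesis gamma_gt0 : 0 < gamma.

Definition tail (v : R) : R := fine (F `[v, +oo[%classic).

Definition tail_int (v : R) : R :=
  fine (\int[F]_(x in `[v, +oo[%classic) x%:E)%E.

Lemma lawU (A B : set R) : measurable A -> measurable B -> A `&` B = set0 ->
  (F (A `|` B) = F A + F B)%E.
Proof. by move=> mA mB AB; rewrite (measureU F). Qed.

Lemma tailE v : (F `[v, +oo[%classic = (tail v)%:E)%E.
Proof. by rewrite fineK// fin_num_measure. Qed.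

Lemma tail_ge0 v : 0 <= tail v.
Proof. exact: fine_ge0. Qed.

Lemma tail_le1 v : tail v <= 1.
Proof. by rewrite -lee_fin -tailE; exact: probability_le1. Qed.

Lemma tail_split a b : a <= b -> (F `[a, b[%classic = (tail a - tail b)%:E)%E.
Proof.
move=> ab; have -> : `[a, b[%classic =
    `[a, +oo[%classic `\` `[b, +oo[%classic :> set R.
  by rewrite set_itv_splitD.
rewrite measureD//=; last by rewrite (le_lt_trans (probability_le1 _ _))// ltry.
rewrite (_ : `[a, +oo[%classic `&` `[b, +oo[%classic =
  `[b, +oo[%classic) ?tailE//.
by apply/setIidPr; apply: subset_itvr; rewrite bnd_simp.
Qed.

Lemma tail_anti a b : a <= b -> tail b <= tail a.
Proof. by move=> ab; rewrite -subr_ge0 -lee_fin -tail_split. Qed.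

Lemma tail_cdf v : tail v = 1 - fine (law_cdf F v).
Proof.
(* The endpoint carries no mass, so the closed tail complements the CDF. *)
have h1 : F `[v, +oo[%classic = F `]v, +oo[%classic.
  rewrite -(setU1itv false)// lawU//; last first.
    by rewrite -subset0 => x /= [-> ]; rewrite in_itv/= ltxx.
  by rewrite F_atomless add0e.
have : (law_cdf F v + F `[v, +oo[%classic = 1)%E.
  rewrite h1 /law_cdf -lawU//; last first.
    rewrite -subset0 => x /=; rewrite !in_itv/= andbT => -[xv vx].
    by move: (lt_le_trans vx xv); rewrite ltxx.
  by rewrite itv_setU_setT probability_setT.
rewrite tailE -(@fineK _ (law_cdf F v)) ?fin_num_measure//.
by rewrite -EFinD => -[<-]; rewrite addrC addKr.
Qed.

Lemma tail_cont : continuous tail.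
Proof.
move=> v; rewrite (_ : tail = fun x => 1 - fine (law_cdf F x)); last first.
  by apply/funext => x; exact: tail_cdf.
apply: cvgB; first exact: cvg_cst.
apply: fine_cvg; rewrite fineK ?fin_num_measure//; exact: F_cont.
Qed.

Lemma measurable_tail : measurable_fun setT tail.
Proof. by apply: continuous_measurable_fun; exact: tail_cont. Qed.

Lemma measurable_tail_le t : measurable [set v | tail v <= t].
Proof.
have := measurable_tail measurableT (measurable_itv `]-oo, t]).
by rewrite setTI set_itvE.
Qed.

Lemma tail_cvgNy t : t < 1 -> exists v, t < tail v.
Proof.
move=> t1; have h :
    (F \o (fun n : nat => `[- n%:R, +oo[%classic)) n @[n --> \oo] --> 1%E.
  have -> : 1%E = F (\bigcup_n `[- n%:R : R, +oo[%classic).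
    rewrite -(probability_setT F); congr (F _); apply/esym.
    rewrite -subTset => x _; exists (Num.truncn `|x|).+1 => //=.
    rewrite in_itv/= andbT lerNl (le_trans (ler_norm _))// normrN.
    by rewrite ltW// truncnS_gt.
  apply: nondecreasing_cvg_mu => //.
    exact: bigcupT_measurable.
  move=> m n mn; apply/subsetPset; apply: subset_itvr.
  by rewrite bnd_simp lerN2 ler_nat.
have {}h : tail (- n%:R) @[n --> \oo] --> (1 : R) by exact: fine_cvg h.
have /cvgr_gt/(_ t t1)[n _ /(_ n (leqnn n))] := h.
by exists (- n%:R).
Qed.

(** The set lies in the half-line starting at its infimum, where the tail is still at most [t] by
    continuity. [tail_cvgNy] bounds the set below when [t < 1]. *)
Lemma law_tail_le t : 0 <= t -> (F [set v | (tail v <= t)%R] <= t%:E)%E.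
Proof.
move=> t0; have mA : measurable [set v | tail v <= t].
  exact: measurable_tail_le.
have [t1|t1] := leP 1 t.
  by apply: le_trans (probability_le1 F mA) _; rewrite lee_fin.
set A := [set v | _]; have [->|A0] := eqVneq A set0.
  by rewrite measure0 lee_fin.
have {}A0 : A !=set0 by exact/set0P.
have [v0 tv0] := tail_cvgNy t1.
have lbA : has_lbound A.
  exists v0 => a /= At; rewrite leNgt; apply/negP => /ltW /tail_anti.
  by rewrite leNgt (le_lt_trans At).
have tw : tail (inf A) <= t.
  rewrite leNgt; apply/negP => tw.
  have /cvgr_gt/(_ t tw)[e /= e0 He] := @tail_cont (inf A).
  have [a At ae] := inf_adherent e0 (conj A0 lbA).
  have ia : inf A <= a by apply: ge_inf.
  have := He a; rewrite /ball/= distrC ger0_norm ?subr_ge0// ltrBlDl => /(_ ae).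
  by rewrite ltNge At.
apply: le_trans (_ : F `[inf A, +oo[%classic <= _)%E;
  last by rewrite tailE lee_fin.
apply: le_measure; rewrite ?inE// => a At.
by rewrite /= in_itv/= andbT; apply: ge_inf.
Qed.

(* Excludes the left endpoints and the interiors of the gaps of the support, and
   every point with no mass above it. *)
Definition strict_tail (v : R) : Prop := forall u, v < u -> tail u < tail v.

(** A failure at [v] is witnessed by a rational [q > v] with [tail v <= tail q]. For fixed [q], the
    set where [tail v <= tail q] contains [[q, +oo[] and by [law_tail_le] has no more mass, so the
    difference is null; countably many [q] remain. *)
Lemma strict_tail_ae : {ae F, forall v, strict_tail v}.
Proof.
pose E n : set R := if @unpickle rat n is Some q then
  [set v | tail v <= tail (ratr q)] `\` `[ratr q, +oo[%classic else set0.
suff: F.-negligible (\bigcup_n E n).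
  apply: negligibleS => v /existsNP[u /not_implyP[vu /negP]];
    rewrite -leNgt => tvu.
  have [q] := rat_in_itvoo vu; rewrite in_itv/= => /andP[vq qu].
  have EE : E (pickle q) =
      [set v | tail v <= tail (ratr q)] `\` `[ratr q, +oo[%classic.
    by rewrite /E pickleK.
  exists (pickle q); first exact: I.
  rewrite EE; split => /=.
    by rewrite (le_trans tvu)// tail_anti// ltW.
  by rewrite in_itv/= andbT; apply/negP; rewrite -ltNge.
apply: negligible_bigcup => n; rewrite /E; case: unpickle => [q|]; last first.
  exact: negligible_set0.
have mA : measurable [set v | tail v <= tail (ratr q)].
  exact: measurable_tail_le.
apply/negligibleP; first exact: measurableD.
apply/eqP; rewrite -measure_le0 measureD//; last first.
  by rewrite (le_lt_trans (probability_le1 _ _))// ltry.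
rewrite (_ : _ `&` _ = `[ratr q, +oo[%classic :> set R) ?tailE; last first.
  by apply/setIidPr => x; rewrite /= in_itv/= andbT; exact: tail_anti.
by rewrite sube_le0; have := law_tail_le (tail_ge0 (ratr q)); rewrite -tailE.
Qed.

Lemma strict_tail_gt0 v : strict_tail v -> 0 < tail v.
Proof.
move=> /(_ (v + 1)); rewrite ltrDl => /(_ ltr01).
by apply: le_lt_trans; exact: tail_ge0.
Qed.

Lemma strict_tail_support v : strict_tail v -> law_support F v.
Proof.
move=> Dv e e0; apply: (@lt_le_trans _ _ (F `[v, v + e[%classic)).
  by rewrite tail_split ?lerDl ?(ltW e0)// lte_fin subr_gt0 Dv// ltrDl.
apply: le_measure; rewrite ?inE//.
  by apply: measurable_ball.
move=> x; rewrite /= in_itv/= /ball/= => /andP[vx xe].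
by rewrite distrC ger0_norm ?subr_ge0// ltrBlDl.
Qed.

Lemma strict_tail_ge0 v : strict_tail v -> 0 <= v.
Proof. by move=> /strict_tail_support/F_nneg. Qed.

(** Almost every point is a [strict_tail] point, hence lies in the support, hence is nonnegative. *)
Lemma law_neg0 : F `]-oo, 0[%classic = 0%E.
Proof.
apply/negligibleP => //; apply: negligibleS strict_tail_ae => v.
by rewrite /= in_itv/= => v0 /strict_tail_ge0; rewrite leNgt v0.
Qed.

Lemma tail0 : tail 0 = 1.
Proof.
apply: EFin_inj; rewrite -tailE -setCitvl probability_setC//.
by rewrite law_neg0 sube0.
Qed.

Lemma law_integrable_id (A : set R) :
  measurable A -> F.-integrable A (EFin : R -> \bar R).
Proof. by move=> mA; apply: integrableS F_int. Qed.

Lemma tail_intE v : (\int[F]_(x in `[v, +oo[%classic) x%:E = (tail_int v)%:E)%E.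
Proof.
by rewrite fineK//; apply: integrable_fin_num => //; exact: law_integrable_id.
Qed.

Lemma tail_int_split a b : a <= b ->
  (\int[F]_(x in `[a, b[%classic) x%:E = (tail_int a - tail_int b)%:E)%E.
Proof.
move=> ab; rewrite EFinB -!tail_intE.
have -> : `[a, +oo[%classic = `[a, b[%classic `|` `[b, +oo[%classic :> set R.
  by apply: itv_bndbnd_setU; rewrite bnd_simp.
rewrite integral_setU//=.
- by rewrite addeK// tail_intE.
- apply/disj_setPS => x /=; rewrite !in_itv/= andbT => -[/andP[_ xb] bx].
  by move: (lt_le_trans xb bx); rewrite ltxx.
Qed.

Lemma tail_int_lb a b : a <= b ->
  a * (tail a - tail b) <= tail_int a - tail_int b.
Proof.
move=> ab; rewrite -lee_fin -tail_int_split// EFinM -tail_split//.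
rewrite -integral_cst//; apply: le_integral => //.
- exact: finite_measure_integrable_cst.
- exact: law_integrable_id.
- by move=> x; rewrite inE/= in_itv/= lee_fin => /andP[].
Qed.

Lemma tail_int_ub a b : a <= b ->
  tail_int a - tail_int b <= b * (tail a - tail b).
Proof.
move=> ab; rewrite -lee_fin -tail_int_split// EFinM -tail_split//.
rewrite -integral_cst//; apply: le_integral => //.
- exact: law_integrable_id.
- exact: finite_measure_integrable_cst.
- by move=> x; rewrite inE/= in_itv/= lee_fin => /andP[_ /ltW].
Qed.

Lemma tail_int_ge b : b * tail b <= tail_int b.
Proof.
rewrite -lee_fin -tail_intE// EFinM -tailE//.
rewrite -integral_cst//; apply: le_integral => //.
- exact: finite_measure_integrable_cst.
- exact: law_integrable_id.
- by move=> x; rewrite inE/= in_itv/= lee_fin andbT.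
Qed.

(** * The scaled conditional mean *)

Local Notation S := tail.
Local Notation M := tail_int.

(** Where no mass remains above [v], division by zero gives 0 and breaks monotonicity. Such points
    form a null set, and comparisons carry a hypothesis of positive tail. *)
Definition scaled_mean (v : R) : R := M v / (gamma * S v).
Local Notation z := scaled_mean.

Lemma tail_pairP : tail_pair S M.
Proof.
split.
- exact: tail_cont.
- exact: tail_ge0.
- exact: tail_le1.
- exact: tail_anti.
- exact: tail_int_lb.
- exact: tail_int_ub.
- exact: tail_int_ge.
- exact: tail0.
Qed.

Lemma tail_int_cont : continuous M.
Proof. exact: tail_integral_cont tail_pairP. Qed.

Let S_cont := tp_cont tail_pairP.
Let S_strict := strict_tail_ae.
Let SM := tail_pairP.
Let tail_at0 : S 0 = 1 := tp_at0 tail_pairP.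

Lemma measurable_scaled_mean : measurable_fun setT z.
Proof.
apply: measurable_funM; first exact: continuous_measurable_fun tail_int_cont.
apply: measurable_funV; first by move=> x; rewrite mulr_ge0 ?tail_ge0// ltW.
apply: measurable_funM => //; exact: continuous_measurable_fun S_cont.
Qed.

Lemma scaled_meanE v : 0 < S v -> M v = gamma * z v * S v.
Proof. by move=> Sv; rewrite /z; field; rewrite !gt_eqF. Qed.

Lemma le_scaled_mean p v : 0 < S v -> (p <= z v) = (gamma * p * S v <= M v).
Proof.
by move=> Sv; rewrite /z ler_pdivlMr ?mulr_gt0// mulrCA mulrA.
Qed.

Lemma scaled_mean_le p v : 0 < S v -> (z v <= p) = (M v <= gamma * p * S v).
Proof.
by move=> Sv; rewrite /z ler_pdivrMr ?mulr_gt0// mulrCA mulrA.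
Qed.

Lemma scaled_mean_mono v u : v <= u -> 0 < S u -> z v <= z u.
Proof.
move=> vu Su; have Sv : 0 < S v by apply: lt_le_trans (tail_anti vu).
rewrite scaled_mean_le// -(ler_pM2r Su).
have := tail_mean_le tail_pairP vu.
by rewrite (scaled_meanE Su) mulrAC.
Qed.

(** Although [z] is flat on gaps, it is strictly increasing, hence injective, on [strict_tail]
    points. *)
Lemma scaled_mean_lt v u : strict_tail v -> v < u -> 0 < S u -> z v < z u.
Proof.
move=> Dv vu Su; have Sv : 0 < S v by exact: strict_tail_gt0.
rewrite ltNge le_scaled_mean// -ltNge -(ltr_pM2r Su).
have := tail_mean_lt tail_pairP (ltW vu) Su (Dv _ vu).
by rewrite (scaled_meanE Su) mulrAC.
Qed.

Lemma scaled_mean0 : gamma * z 0 = M 0.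
Proof. by rewrite (@scaled_meanE 0) tail_at0// mulr1. Qed.

Lemma scaled_mean_ge v : strict_tail v -> z 0 <= z v.
Proof.
move=> Dv; apply: scaled_mean_mono; last exact: strict_tail_gt0.
exact: strict_tail_ge0 Dv.
Qed.

Lemma tail_int_ge0 v : 0 <= M v.
Proof.
have [v0|v0] := leP 0 v.
  by apply: le_trans (tail_int_ge v); rewrite mulr_ge0// tail_ge0.
have M0 : 0 <= M 0 by have := tail_int_ge 0; rewrite mul0r.
have Sv : S v - S 0 = 0.
  by apply/eqP; rewrite tail_at0 subr_eq0 eq_le tail_le1 -tail_at0 tail_anti//
    ltW.
by have := tail_int_lb (ltW v0); rewrite Sv mulr0 subr_ge0; exact: le_trans.
Qed.

Lemma scaled_mean_ge0 v : 0 <= z v.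
Proof. by rewrite divr_ge0 ?tail_int_ge0// mulr_ge0 ?tail_ge0// ltW. Qed.

(** By injectivity on [strict_tail] points, a level set of [z] is a null set plus at most one point,
    and [F] has no atoms. *)
Lemma scaled_mean_atomless c : F [set v | z v = c] = 0%E.
Proof.
have mc : measurable [set v | z v = c].
  have := measurable_scaled_mean measurableT (measurable_set1 c).
  by rewrite setTI.
apply/negligibleP; first exact: mc.
have [[a [Da za]]|no] := pselect (exists a, strict_tail a /\ z a = c);
  last first.
  apply: negligibleS S_strict => v /= zv Dv; apply: no; exists v; split => //.
suff : F.-negligible ((~` strict_tail) `|` [set a]).
  apply: negligibleS => v /= zv; have [Dv|] := pselect (strict_tail v);
    last by left.
  right => /=; have [va|av|//] := ltgtP v a.
    by have := scaled_mean_lt Dv va (strict_tail_gt0 Da); rewrite zv za ltxx.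
  by have := scaled_mean_lt Da av (strict_tail_gt0 Dv); rewrite zv za ltxx.
apply: negligibleU; first exact: S_strict.
by apply/negligibleP => //; exact: F_atomless.
Qed.

Lemma ae_strict (P : R -> Prop) :
  (forall v, strict_tail v -> P v) -> {ae F, forall v, P v}.
Proof.
by move=> DP; apply: negligibleS S_strict => v; apply: contra_not; exact: DP.
Qed.

Lemma measurable_ge_mean p : measurable [set v | p <= z v].
Proof.
have := measurable_scaled_mean measurableT (measurable_itv `[p, +oo[).
by rewrite setTI set_itvE.
Qed.

Lemma measurable_le_mean p : measurable [set v | z v <= p].
Proof.
have := measurable_scaled_mean measurableT (measurable_itv `]-oo, p]).
by rewrite setTI set_itvE.
Qed.

(** * The threshold rule as a superlevel set of [z] *)

Lemma ros_feasible p t : 0 < p ->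
  ((gamma * p)%:E <= mean_above F t)%E <-> 0 < S t /\ p <= z t.
Proof.
move=> p0; rewrite /mean_above.
have -> : [set v : R | t <= v] = `[t, +oo[%classic by rewrite set_itvE.
have mI : measurable (`[t, +oo[%classic : set R) by [].
have gp : 0 < gamma * p by rewrite mulr_gt0.
have [St|] := ltP 0 (S t).
  rewrite tail_intE (tailE t) inver gt_eqF// -EFinM lee_fin ler_pdivlMr//.
  by rewrite -le_scaled_mean//; split => // -[].
move=> S0; have FI0 : F `[t, +oo[%classic = 0%E.
  by rewrite tailE; congr EFin; apply/eqP; rewrite eq_le S0 tail_ge0.
by rewrite FI0 null_set_integral// mul0e lee_fin leNgt gp; split => // -[].
Qed.

Lemma vm_purchase_mean p : 0 < p -> vm_purchase_prob F gamma p =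
  F [set v | p <= z v].
Proof.
move=> p0; rewrite /vm_purchase_prob.
have mth : measurable [set v : R | (threshold F gamma p <= v%:E)%E].
  case: (threshold F gamma p) => [r| |].
  - rewrite (_ : mkset _ = `[r, +oo[%classic); first exact: measurable_itv.
    by apply/seteqP; split => v /=; rewrite in_itv/= andbT lee_fin.
  - rewrite (_ : mkset _ = set0); first exact: measurable0.
    by rewrite -subset0 => v /=; rewrite leye_eq.
  - rewrite (_ : mkset _ = setT); first exact: measurableT.
    by apply/seteqP; split => v //= _; exact: leNye.
(* Just above the threshold a feasible cutoff exists, but the threshold itself is only an infimum;
   the single point [c] is discarded. For an infinite threshold [c] is a harmless default. *)
set c := fine (threshold F gamma p).
apply: ae_measure_eq => //; first exact: measurable_ge_mean.
have c_ae : {ae F, forall v, v <> c}.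
  have : F.-negligible [set c] by apply/negligibleP => //; exact: F_atomless.
  by apply: negligibleS => v /= /contrapT.
apply: (filterS2 (F := nbhs (almost_everywhere F))) S_strict c_ae => v Dv vc /=.
have Sv := strict_tail_gt0 Dv.
split; last first.
  move=> pz; apply: ereal_inf_lbound; exists v => //; split.
    exact: strict_tail_support Dv.
  by apply/ros_feasible.
rewrite le_eqVlt => /orP[/eqP thv|]; first by case: vc; rewrite /c thv.
move=> /ereal_inf_lt[_ [t [_ /ros_feasible -/(_ p0)[St pzt]] <-]];
  rewrite lte_fin => tv.
by apply: le_trans pzt _; apply: scaled_mean_mono => //; exact: ltW.
Qed.

(** * Revenue identity, virtual value and weight *)

Definition mean_tail (p : R) : R := fine (F [set v | p <= z v]).
Local Notation Q := mean_tail.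

Lemma mean_tailE p : F [set v | p <= z v] = (Q p)%:E.
Proof. by rewrite fineK// fin_num_measure//; exact: measurable_ge_mean. Qed.

Lemma mean_tail_ge0 p : 0 <= Q p.
Proof. exact: fine_ge0. Qed.

Lemma mean_tail_anti p r : p <= r -> Q r <= Q p.
Proof.
move=> pr; rewrite -lee_fin -!mean_tailE; apply: le_measure; rewrite ?inE.
- exact: measurable_ge_mean.
- exact: measurable_ge_mean.
- by move=> v /=; exact: le_trans.
Qed.

Lemma mean_tail1 p : p <= z 0 -> Q p = 1.
Proof.
move=> pz; apply: EFin_inj; rewrite -mean_tailE -(probability_setT F).
apply: ae_measure_eq => //; first exact: measurable_ge_mean.
apply: ae_strict => v Dv; split => //= _.
by apply: le_trans pz _; exact: scaled_mean_ge.
Qed.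

(** Some [strict_tail] point accepts [p]; a slight move to the right keeps the tail positive and
    makes the inequality strict. *)
Lemma mean_tail_exceeds p : 0 < Q p -> mean_exceeds S M (gamma * p).
Proof.
move=> Qp; have [v Dv pv] : exists2 v, strict_tail v & p <= z v.
  apply: contrapT => no; move: Qp; suff -> : Q p = 0 by rewrite ltxx.
  apply: EFin_inj; rewrite -mean_tailE; apply: etrans (measure0 F).
  apply: ae_measure_eq => //; first exact: measurable_ge_mean.
  by apply: ae_strict => v Dv; split => //= pv; apply: no; exists v.
have [u vu Su] := tail_gt0_right SM (strict_tail_gt0 Dv).
exists u => //; rewrite ltNge -scaled_mean_le// -ltNge.
by apply: le_lt_trans pv _; exact: scaled_mean_lt.
Qed.

(* The set of valuations accepting [c] is, up to a null set, the half-line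
   [v >= t] where the return-on-spend constraint binds at [t]. *)
Lemma mean_tail_integral c : z 0 <= c ->
  (\int[F]_(v in [set v | (c <= z v)%R]) v%:E =
    (gamma * c)%:E * F [set v | (c <= z v)%R])%E.
Proof.
move=> c0; rewrite mean_tailE.
have mid : measurable_fun setT (EFin : measurableTypeR R ->
  \bar R) by exact: measurable_int F_int.
have := mean_tail_ge0 c; rewrite le_eqVlt => /orP[/eqP Q0|Q0].
  rewrite -Q0 mule0 null_set_integral//.
  - exact: measurable_ge_mean.
  - by have := mean_tailE c; rewrite -Q0.
have gc : M 0 <= gamma * c.
  by rewrite -scaled_mean0 ler_pM2l.
have [t St Mt] := mean_root SM gc (mean_tail_exceeds Q0).
(* The binding point may lie in a gap, so it need not be a [strict_tail] point; only its positive
   tail is used. *)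
have zt : z t = c.
  apply: (mulfI (lt0r_neq0 gamma_gt0)); apply: (mulIf (lt0r_neq0 St)).
  by rewrite -scaled_meanE.
have cE : {ae F, forall v : R, c <= z v <-> `[t, +oo[%classic v}.
  apply: ae_strict => v Dv; rewrite /= in_itv/= andbT; split => [cv|tv].
    rewrite leNgt; apply/negP => vt.
    have := scaled_mean_lt Dv vt St.
    by rewrite zt ltNge cv.
  by rewrite -zt; apply: scaled_mean_mono => //; exact: strict_tail_gt0.
have mc := measurable_ge_mean c.
have mt : measurable (`[t, +oo[%classic : set R) by [].
have I1 := @ae_integral_set _ _ _ F _ _ _ mc mt mid cE;
  have E1 := @ae_measure_eq _ _ _ F _ _ mc mt cE.
apply: etrans I1 _; apply: etrans (tail_intE t) _.
by rewrite Mt EFinM; congr (_ * _)%E; rewrite -mean_tailE -tailE -E1.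
Qed.

(* The virtual value of the constructed law above [z 0]. The value [0] below
   [z 0] stands for [-oo] there and keeps [virt] real-valued and monotone. *)
Definition virt (p : R) : R :=
  if p <= z 0 then 0
  else if 0 < Q p then mean_inv S M (gamma * p) / gamma else p.

Let gz0 := scaled_mean0.

Lemma virt_lt p : z 0 < p -> 0 < Q p -> virt p < p.
Proof.
move=> zp Qp; rewrite /virt leNgt zp/= Qp ltr_pdivrMr// [ltRHS]mulrC.
apply: (mean_inv_lt SM); last exact: mean_tail_exceeds.
by rewrite -gz0 ler_pM2l// ltW.
Qed.

Lemma virt_le p : 0 <= p -> virt p <= p.
Proof.
move=> p0; have [pz|zp] := leP p (z 0); first by rewrite /virt pz.
have [Qp|Qp] := ltP 0 (Q p); first by apply: ltW; exact: virt_lt.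
by rewrite /virt (leNgt p) zp/= (ltNge 0) Qp.
Qed.

(** The middle branch is monotone through [mean_inv]. It dominates the lower branch since [mean_inv]
    is nonnegative there, and stays below the upper one since [virt p <= p <= r]. *)
Lemma virt_mono : {homo virt : p r / p <= r}.
Proof.
have z0 : 0 <= z 0 by exact: scaled_mean_ge0.
have M0 p : z 0 < p -> M 0 <= gamma * p by move=> /ltW zp;
  rewrite -gz0 ler_pM2l.
have T0 p : z 0 < p -> 0 < Q p -> 0 <= mean_inv S M (gamma * p).
  move=> zp Qp; apply: ub_le_sup; last exact: (below_mean0 SM (M0 _ zp)).
  by case: (has_sup_below_mean SM (M0 _ zp) (mean_tail_exceeds Qp)).
move=> p r pr; have [rz|zr] := leP r (z 0).
  by rewrite /virt rz (le_trans pr rz).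
have [Qr|Qr] := ltP 0 (Q r).
  rewrite [virt r]/virt (leNgt r) zr/= Qr /virt; have [_|zp] := leP p (z 0).
    by rewrite divr_ge0 ?T0// ltW.
  have Qp : 0 < Q p by apply: lt_le_trans Qr _; exact: mean_tail_anti.
  rewrite Qp ler_pM2r ?invr_gt0//; apply: (mean_inv_le SM); first exact: M0.
    exact: mean_tail_exceeds.
  by rewrite ler_pM2l.
rewrite [virt r]/virt (leNgt r) zr/= ltNge Qr/=.
have [pz|zp] := leP p (z 0); first by rewrite /virt pz (le_trans z0)// ltW.
by rewrite (le_trans _ pr)// virt_le// (le_trans z0)// ltW.
Qed.

Lemma mean_tail_gt0 v : strict_tail v -> 0 < Q (z v).
Proof.
move=> Dv; have Sv := strict_tail_gt0 Dv.
rewrite (lt_le_trans Sv)// -lee_fin -tailE -mean_tailE//.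
apply: ae_measure_le => //; first exact: measurable_ge_mean.
apply: ae_strict => u Du; rewrite /= in_itv/= andbT => vu.
by apply: scaled_mean_mono => //; exact: strict_tail_gt0.
Qed.

(** At a [strict_tail] point [v], any [t > v] of positive tail has larger mean, so [v] is the
    maximum of [below_mean]. *)
Lemma virt_scaled_mean v : strict_tail v -> z 0 < z v -> virt (z v) = v / gamma.
Proof.
move=> Dv zv; have Sv := strict_tail_gt0 Dv.
rewrite /virt leNgt zv/= mean_tail_gt0//; congr (_ / _).
have vin : below_mean S M (gamma * z v) v by split => //; rewrite -scaled_meanE.
have vub : ubound (below_mean S M (gamma * z v)) v.
  move=> t [St Mt]; rewrite leNgt; apply/negP => vt.
  have := scaled_mean_lt Dv vt St.
  by rewrite ltNge scaled_mean_le// Mt.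
apply/eqP; rewrite eq_le; apply/andP; split.
  by apply: ge_sup => //; exists v.
by apply: ub_le_sup => //; exists v.
Qed.

(** Cut to 0 up to [z 0], just as [mean_tail_above] is: the tail equals 1 there and would have
    infinite Lebesgue integral over a half-line. *)
Definition weight (p : R) : R := if p <= z 0 then 0 else p - virt p.

Lemma weight_ge0 p : 0 <= weight p.
Proof.
rewrite /weight; have [//|zp] := leP p (z 0).
rewrite subr_ge0 virt_le//; apply: le_trans (ltW zp); exact: scaled_mean_ge0.
Qed.

Lemma measurable_weight : measurable_fun setT weight.
Proof.
apply: measurable_fun_if => //.
- exact: measurable_fun_ler.
- apply: measurable_funTS; apply: measurable_funB => //.
  by apply: nondecreasing_measurable => // p r; exact: virt_mono.
Qed.

Lemma weight_scaled_mean v : strict_tail v -> z 0 < z v ->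
  weight (z v) = z v - v / gamma.
Proof. by move=> Dv zv; rewrite /weight leNgt zv/= virt_scaled_mean. Qed.

Lemma weight_gt0 p : z 0 < p -> 0 < Q p -> 0 < weight p.
Proof. by move=> zp Qp; rewrite /weight leNgt zp/= subr_gt0 virt_lt. Qed.

Let ae_neq c : {ae F, forall v, z v <> c}.
Proof.
have mc : measurable [set v | z v = c].
  by have := measurable_scaled_mean measurableT (measurable_set1 c);
    rewrite setTI.
have : F.-negligible [set v | z v = c].
  by apply/negligibleP; [exact: mc | exact: scaled_mean_atomless].
by apply: negligibleS => v /= /contrapT.
Qed.

Lemma ae_strict_neq c (P : R -> Prop) :
  (forall v, strict_tail v -> z v <> c -> P v) -> {ae F, forall v, P v}.
Proof.
move=> DP; suff : F.-negligible ((~` strict_tail) `|` [set v | z v = c]).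
  apply: negligibleS => v nP; have [Dv|] := pselect (strict_tail v);
    last by left.
  by right; apply: contrapT => zc; apply: nP; exact: DP.
apply: negligibleU; first exact: S_strict.
by have := ae_neq c; apply: negligibleS => v /= -> /(_ erefl).
Qed.

(** * Two evaluations of the truncated mean *)

Definition mean_tail_above (p : R) : R := if p <= z 0 then 0 else Q p.

Lemma mean_tail_above_ge0 p : 0 <= mean_tail_above p.
Proof.
by rewrite /mean_tail_above; case: ifP => // _; exact: mean_tail_ge0.
Qed.

Lemma measurable_mean_tail : measurable_fun setT Q.
Proof. by apply: nonincreasing_measurable => // p r; exact: mean_tail_anti. Qed.

Lemma measurable_mean_tail_above : measurable_fun setT mean_tail_above.
Proof.
apply: measurable_fun_if => //.
- exact: measurable_fun_ler.
- apply: measurable_funTS; exact: measurable_mean_tail.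
Qed.

Let mz : measurable_fun (setT : set (measurableTypeR R)) (z : measurableTypeR R
  -> measurableTypeR R).
Proof. exact: measurable_scaled_mean. Qed.

(** The tail of [min (z v) d] is 1 on [[0, z 0]], then [Q] up to [d], then 0; the breakpoints are
    Lebesgue-null. *)
Lemma layer_cake_mean d : z 0 <= d ->
  (\int[F]_v (Num.min (z v) d)%:E =
   (z 0)%:E + \int[lebesgue_measure]_(p in `]-oo, d]%classic) (mean_tail_above
     p)%:E)%E.
Proof.
move=> zd; pose Xf v := Num.min (z v) d.
have mX : measurable_fun (setT : set (measurableTypeR R)) Xf.
  by apply: measurable_minr => //; exact: measurable_scaled_mean.
pose X : {RV F >-> R} := HB.pack Xf (isMeasurableFun.Build _ _ _ _ _ mX).
have X0 v : 0 <= X v by rewrite /= /Xf le_min scaled_mean_ge0 (le_trans _ zd)//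
  scaled_mean_ge0.
have := ge0_expectation_ccdf X0; rewrite expectation_def => ->.
rewrite integral_mkcond.
have z00 : 0 <= z 0 by exact: scaled_mean_ge0.
have mQ := measurable_mean_tail_above.
transitivity (\int[lebesgue_measure]_r ((\1_(`[0, z 0]%classic) r)%:E +
    ((EFin \o mean_tail_above) \_ `]-oo, d]%classic) r))%E.
  apply: ae_eq_integral => //.
  - apply/(measurable_restrictT _ _).1 => //; apply: measurable_funTS;
      exact: ccdf_measurable.
  - apply: emeasurable_funD; first exact/measurable_EFinP/measurable_indic.
    apply/(measurable_restrictT _ _).1 => //;
      exact/measurable_funTS/measurable_EFinP.
  exists [set z 0; d]; split.
  - exact: measurableU.
  - by apply: countable_lebesgue_measure0;
      exact/finite_set_countable/finite_set2.
  move=> r /=; apply: contra_notP => /not_orP[rz rd] _.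
  rewrite !patchE indicE !mem_setE !in_itv/= !andbT /mean_tail_above.
  have ccdfE : ccdf X r = F [set v | r < Num.min (z v) d].
    by congr (F _); apply/seteqP; split => v; rewrite /= in_itv/= andbT.
  have mccdf : measurable [set v | r < Num.min (z v) d].
    have := mX measurableT _ (measurable_itv `]r, +oo[).
    by rewrite setTI set_itvE.
  have [r0|r0] := ltP r 0.
    by rewrite !(le_trans (ltW r0))//= ?add0e// (le_trans z00).
  have [rz0|z0r|//] := ltgtP r (z 0).
    rewrite (le_trans (ltW rz0) zd) adde0 ccdfE;
      apply: etrans (probability_setT F).
    apply: ae_measure_eq => //; apply: ae_strict => v Dv; split => //= _.
    by rewrite lt_min !(lt_le_trans rz0)// scaled_mean_ge.
  rewrite add0e ccdfE; have [rd0|dr|//] := ltgtP r d.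
    rewrite -mean_tailE; apply: ae_measure_eq => //;
      first exact: measurable_ge_mean.
    apply: (ae_strict_neq (c := r)) => v Dv zr /=.
    by rewrite lt_min rd0 andbT le_eqVlt; split => [->|/orP[/eqP|//]];
      rewrite ?orbT// => /esym.
  apply: etrans (measure0 F); congr (F _); rewrite -subset0 => v /=.
  by rewrite lt_min (ltNge r d) (ltW dr) andbF.
rewrite ge0_integralD//.
- rewrite integral_indic// setIT -integral_mkcond; congr (_ + _)%E.
  apply: etrans (lebesgue_measure_itv `[0, z 0]) _; rewrite /= lte_fin;
    case: ltP => [_|z0]; first by rewrite oppr0 adde0.
  by congr EFin; apply/eqP; rewrite eq_le z0 z00.
- by apply/measurable_EFinP/measurable_indic.
- move=> r _; apply: erestrict_ge0 => s _; rewrite lee_fin;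
    exact: mean_tail_above_ge0.
- apply/(measurable_restrictT _ _).1 => //. apply: measurable_funTS;
    exact/measurable_EFinP.
Qed.

(** The marginal revenue [v / gamma], truncated to be nonnegative everywhere; almost everywhere the
    truncation changes nothing. *)
Let h (v : R) : R := Num.max v 0 / gamma.

Let h_ge0 v : 0 <= h v.
Proof. by rewrite divr_ge0 ?le_max ?lexx ?orbT// ltW. Qed.

Let measurable_h : measurable_fun setT h.
Proof.
apply: measurable_funM; last exact: measurable_cst.
by apply: measurable_maxr; [exact: measurable_id | exact: measurable_cst].
Qed.

Let integral_h (B : set R) : measurable B ->
  (\int[F]_(v in B) (h v)%:E = gamma^-1%:E * \int[F]_(v in B) v%:E)%E.
Proof.
move=> mB; rewrite -integralZl//; last exact: law_integrable_id.
apply: ae_eq_integral => //.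
- by apply: measurable_funTS; exact/measurable_EFinP.
- by apply: emeasurable_funM => //; exact: measurable_int (law_integrable_id
    mB).
- apply: ae_strict => v Dv _; rewrite -EFinM; congr EFin.
  by rewrite /h max_l ?(strict_tail_ge0 Dv)// mulrC.
Qed.

(** Where [z v <= d], the minimum is [h v + weight (z v)] almost everywhere; above [d], the revenue
    identity replaces the constant [d] by [h]. The full integral of [h] is [z 0]. *)
Lemma weighted_mean d : z 0 <= d ->
  (\int[F]_v (Num.min (z v) d)%:E =
   (z 0)%:E + \int[F]_(v in [set v | (z v <= d)%R]) (weight (z v))%:E)%E.
Proof.
move=> zd; set B : set R := [set v | z v <= d].
have mB : measurable B by exact: measurable_le_mean.
have mz' := measurable_scaled_mean.
have mh : measurable_fun setT (EFin \o h) by apply/measurable_EFinP;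
  exact: measurable_h.
have mw : measurable_fun setT (EFin \o (weight \o z)).
  apply/measurable_EFinP; apply: measurableT_comp => //;
    exact: measurable_weight.
have mm : measurable_fun setT (fun v => (Num.min (z v) d)%:E).
  by apply/measurable_EFinP; exact: measurable_minr.
have d0 : 0 <= d by rewrite (le_trans _ zd)// scaled_mean_ge0.
have hT : (\int[F]_v (h v)%:E = (z 0)%:E)%E.
  rewrite integral_h//.
  have -> : (\int[F]_v v%:E = (M 0)%:E)%E.
    apply: etrans (tail_intE 0); apply: ae_integral_set => //.
    - by apply: ae_strict => v Dv; rewrite /= in_itv/= andbT (strict_tail_ge0
        Dv).
  by rewrite -gz0 -EFinM mulrA mulVf ?mul1r// gt_eqF.
have hC : (\int[F]_(v in ~` B) (h v)%:E =
  \int[F]_(v in ~` B) (Num.min (z v) d)%:E)%E.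
  have mC : measurable (~` B) by exact: measurableC.
  have CE : {ae F, forall v, (~` B) v <-> [set v : R | d <= z v] v}.
    apply: (ae_strict_neq (c := d)) => v Dv zvd; rewrite /B/=; split.
      by move=> /negP; rewrite -ltNge => /ltW.
    by rewrite le_eqVlt => /orP[/eqP/esym//|dz]; apply/negP; rewrite -ltNge.
  have md := measurable_ge_mean d.
  have mid : measurable_fun setT (EFin : measurableTypeR R ->
    \bar R) by exact: measurable_int F_int.
  have FC : F (~` B) = F [set v | d <= z v] by apply: ae_measure_eq.
  have IC : (\int[F]_(v in ~` B) v%:E =
    \int[F]_(v in [set v | (d <= z v)%R]) v%:E)%E.
    exact: (@ae_integral_set _ _ _ F _ _ _ mC md mid CE).
  rewrite integral_h// IC mean_tail_integral//.
  rewrite -FC muleA -EFinM mulrA mulVf ?gt_eqF// mul1r -integral_cst//.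
  by apply: eq_integral => v; rewrite inE => /negP; rewrite -ltNge => /ltW dz;
    rewrite min_r.
have min_ge0 v : (0 <= (Num.min (z v) d)%:E)%E.
  by rewrite lee_fin le_min scaled_mean_ge0.
have hB : (\int[F]_(v in B) (Num.min (z v) d)%:E =
    \int[F]_(v in B) (h v)%:E + \int[F]_(v in B) (weight (z v))%:E)%E.
  rewrite -ge0_integralD//; last 4 first.
  - by move=> v _; rewrite lee_fin h_ge0.
  - exact: measurable_funS mh.
  - by move=> v _; rewrite lee_fin weight_ge0.
  - exact: measurable_funS mw.
  apply: ae_eq_integral => //.
  - exact: measurable_funS mm.
  - apply: emeasurable_funD; [exact: measurable_funS mh | exact: measurable_funS
      mw].
  apply: (ae_strict_neq (c := z 0)) => v Dv zv Bv.
  have zv0 : z 0 < z v by rewrite lt_neqAle scaled_mean_ge// andbT eq_sym;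
    apply/eqP.
  rewrite -EFinD min_l// weight_scaled_mean// /h max_l ?(strict_tail_ge0 Dv)//.
  by rewrite addrC subrK.
have dBC : [disjoint B & ~` B] by apply/disj_setPS => x [].
have mCB : measurable (~` B) by exact: measurableC.
rewrite -hT -(setUv B) ge0_integral_setU//; last by rewrite setUv.
rewrite ge0_integral_setU//; [|by rewrite setUv|by move=> v _;
  rewrite lee_fin h_ge0].
by rewrite hB hC addeAC.
Qed.

(** * Density and regularity of the law of [z] *)

Let z_mfun : {mfun measurableTypeR R >-> measurableTypeR R} :=
  HB.pack (z : measurableTypeR R -> measurableTypeR R) (isMeasurableFun.Build _
    _ _ _ _ mz).

Definition mean_law : law R := distribution F z_mfun.

Lemma mean_lawE (A : set R) : mean_law A = F (z @^-1` A).
Proof. by []. Qed.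

Lemma mean_law_atomless x : mean_law [set x] = 0%E.
Proof. exact: scaled_mean_atomless. Qed.

Lemma ge0_integral_mean_law (A : set R) (k : R -> \bar R) :
  measurable A -> measurable_fun setT k -> (forall x, 0 <= k x)%E ->
  (\int[mean_law]_(p in A) k p = \int[F]_(v in z @^-1` A) k (z v))%E.
Proof.
move=> mA mk k0; apply: (ge0_integral_pushforward mz F mA) => //.
exact: measurable_funTS.
Qed.

Let m_weight : measurable_fun setT (fun p => (weight p)%:E).
Proof. by apply/measurable_EFinP; exact: measurable_weight. Qed.

(** The finite term [z 0] cancels between the two evaluations. Finiteness, needed for uniqueness of
    measures, follows from [min (z v) d <= d]. *)
Lemma mean_law_weight_halfline d :
  (\int[mean_law]_(p in `]-oo, d[%classic) (weight p)%:E =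
   \int[lebesgue_measure]_(p in `]-oo, d[%classic) (mean_tail_above p)%:E)%E /\
  (\int[mean_law]_(p in `]-oo, d[%classic) (weight p)%:E < +oo)%E.
Proof.
have md : measurable (`]-oo, d[%classic : set R) by exact: measurable_itv.
have [dz|zd] := leP d (z 0).
  rewrite !integral0_eq//.
  - by move=> p; rewrite /= in_itv/= => pd;
      rewrite /mean_tail_above (le_trans (ltW pd)).
  - by move=> p; rewrite /= in_itv/= => pd; rewrite /weight (le_trans (ltW pd)).
have mB : measurable [set v | z v <= d] by exact: measurable_le_mean.
have -> : (\int[mean_law]_(p in `]-oo, d[%classic) (weight p)%:E =
    \int[F]_(v in [set v | (z v <= d)%R]) (weight (z v))%:E)%E.
  rewrite ge0_integral_mean_law//; last by move=> x; rewrite lee_fin weight_ge0.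
  apply: (@ae_integral_set _ _ _ F) => //.
  - by have := mz measurableT md; rewrite setTI.
  - apply/measurable_EFinP; apply: measurableT_comp;
      first exact: measurable_weight.
    exact: measurable_scaled_mean.
  - apply: (ae_strict_neq (c := d)) => v _ zvd; rewrite /= in_itv/=.
    by rewrite le_eqVlt; split => [->|/orP[/eqP//|//]]; rewrite ?orbT.
have -> : (\int[lebesgue_measure]_(p in `]-oo, d[%classic) (mean_tail_above
  p)%:E =
    \int[lebesgue_measure]_(p in `]-oo, d]%classic) (mean_tail_above p)%:E)%E.
  apply: integral_itv_bndo_bndc; apply: measurable_funTS.
  by apply/measurable_EFinP; exact: measurable_mean_tail_above.
have I1 := weighted_mean (ltW zd); have I2 := layer_cake_mean (ltW zd).
split.
  have : ((z 0)%:E + \int[F]_(v in [set v | (z v <= d)%R]) (weight (z v))%:E =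
    (z 0)%:E + \int[lebesgue_measure]_(p in `]-oo, d]%classic) (mean_tail_above
      p)%:E)%E.
    by rewrite -I1 -I2.
  by move/(congr1 (fun t => t - (z 0)%:E)%E);
    rewrite ![((z 0)%:E + _)%E]addeC !addeK.
apply: (@le_lt_trans _ _ (\int[F]_v d%:E)%E); last first.
  by rewrite integral_cst// [X in (_ * X)%E](probability_setT F) mule1 ltry.
apply: (@le_trans _ _ (\int[F]_v (Num.min (z v) d)%:E)%E).
  by rewrite I1 leeDr// lee_fin scaled_mean_ge0.
apply: ge0_le_integral => //.
- by move=> v _; rewrite lee_fin le_min scaled_mean_ge0 (le_trans _ (ltW zd))//
    scaled_mean_ge0.
- apply/measurable_EFinP; apply: measurable_minr => //;
    exact: measurable_scaled_mean.
- by move=> v _; rewrite lee_fin ge_min lexx orbT.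
Qed.

(* The revenue identity [gamma * c * Q c = E[v; z v >= c]] says
   [d (p * Q) = virt dQ], that is [Q dp = (p - virt p) dG]. *)
Lemma mean_law_weight (A : set R) : measurable A ->
  (\int[mean_law]_(p in A) (weight p)%:E =
   \int[lebesgue_measure]_(p in A) (mean_tail_above p)%:E)%E.
Proof.
move=> mA.
have [m1 m1E] := density_measure (mean_law : {measure set (measurableTypeR R) ->
  \bar R}) weight_ge0 measurable_weight.
have [m2 m2E] := density_measure (@lebesgue_measure R) mean_tail_above_ge0
  measurable_mean_tail_above.
rewrite -m1E -m2E; apply: (measure_unique_halflines (m1 := m1) (m2 :=
  m2)) => //.
- by move=> x; rewrite m1E m2E; case: (mean_law_weight_halfline x).
- by move=> x; rewrite m1E; case: (mean_law_weight_halfline x).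
Qed.

Definition mean_density (p : R) : R := mean_tail_above p / weight p.

Lemma measurable_weightV : measurable_fun setT (fun p => (weight p)^-1).
Proof. by apply: measurable_funV; [exact: weight_ge0 | exact:
  measurable_weight]. Qed.

(** Integrates the inverse of [weight] against the measure [m1], described once by [mean_law] and
    once by Lebesgue measure. The cancellation requires positive [weight], which holds at [z v] for
    [strict_tail] points with [z v] different from [z 0]. *)
Lemma mean_law_has_density : has_density mean_law mean_density.
Proof.
split.
- apply: measurable_funM; first exact: measurable_mean_tail_above.
  exact: measurable_weightV.
- by move=> p; rewrite divr_ge0 ?mean_tail_above_ge0 ?weight_ge0.
move=> A mA.
have wV0 x : (0 <= ((weight x)^-1)%:E)%E by rewrite lee_fin invr_ge0 weight_ge0.
have mwV : measurable_fun setT (fun p => ((weight p)^-1)%:E).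
  by apply/measurable_EFinP; exact: measurable_weightV.
have [m1 m1E] := density_measure (mean_law : {measure set (measurableTypeR R) ->
  \bar R}) weight_ge0 measurable_weight.
transitivity (\int[m1]_(p in A) ((weight p)^-1)%:E)%E; last first.
  rewrite (ge0_integral_density (mu := @lebesgue_measure R) (f :=
    mean_tail_above))//.
  - exact: mean_tail_above_ge0.
  - exact: measurable_mean_tail_above.
  - by move=> B mB; rewrite m1E; exact: mean_law_weight.
rewrite (ge0_integral_density (mu := mean_law) (f := weight))//; last 2 first.
- exact: weight_ge0.
- exact: measurable_weight.
rewrite ge0_integral_mean_law//; last 2 first.
- exact: emeasurable_funM.
- by move=> x; rewrite mule_ge0// lee_fin weight_ge0.
have mzA : measurable (z @^-1` A) by have := mz measurableT mA; rewrite setTI.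
rewrite -[LHS]mul1e -(integral_cst F mzA).
apply: ae_eq_integral => //.
- apply: measurable_funTS; apply/measurable_EFinP; apply: measurable_funM.
    by apply: measurableT_comp; [exact: measurable_weight | exact:
      measurable_scaled_mean].
  by apply: (measurableT_comp measurable_weightV);
    exact: measurable_scaled_mean.
- apply: (ae_strict_neq (c := z 0)) => v Dv zv _.
  have zv0 : z 0 < z v by rewrite lt_neqAle scaled_mean_ge// andbT eq_sym;
    apply/eqP.
  by rewrite -EFinM divff// gt_eqF// weight_gt0// mean_tail_gt0.
Qed.

Lemma mean_law_cdf p : law_cdf mean_law p = (1 - Q p)%:E.
Proof.
have mB := measurable_le_mean p; have mC := measurable_ge_mean p.
have : F [set v | z v <= p] = (1 - F [set v | (p <= z v)%R])%E.
  rewrite -probability_setC//; apply: ae_measure_eq => //;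
    first exact: measurableC.
  apply: (ae_strict_neq (c := p)) => v _ zp /=; split => [zvp|/negP];
    last first.
    by rewrite -ltNge => /ltW.
  by apply/negP; rewrite -ltNge lt_neqAle zvp andbT; apply/eqP.
rewrite mean_tailE -EFinB => <-; rewrite /law_cdf mean_lawE; congr (F _).
Qed.

Lemma mean_law_virtual_value p :
  virtual_value mean_law mean_density p =
    if p <= z 0 then -oo%E else (virt p)%:E.
Proof.
rewrite /virtual_value mean_law_cdf.
have -> : (1 - (1 - Q p)%:E = (Q p)%:E)%E by rewrite -EFinB opprB addrC subrK.
rewrite inver /mean_density /mean_tail_above.
have [pz|zp] := leP p (z 0).
  (* Zero density with full mass remaining: the quotient is [1 / 0 = +oo]. *)
  by rewrite mul0r eqxx mean_tail1// mul1e.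
have := mean_tail_ge0 p; rewrite le_eqVlt => /orP[/eqP Q0|Q0].
  (* No mass remains, so the quotient is 0 and the value is [p], as in the last branch of [virt]. *)
  by rewrite -Q0 mul0e sube0 /virt leNgt zp -Q0 ltxx.
have w0 := weight_gt0 zp Q0.
rewrite gt_eqF ?divr_gt0// -EFinM -EFinB; congr EFin.
rewrite invf_div mulrC -mulrA mulVf ?gt_eqF// mulr1.
by rewrite /weight (leNgt p) zp/= opprB addrC subrK.
Qed.

Lemma mean_law_regular : regular mean_law mean_density.
Proof.
move=> p r pr; rewrite !mean_law_virtual_value.
have [//|zp] := leP p (z 0); first by rewrite leNye.
by rewrite (leNgt r) (lt_le_trans zp pr)/= lee_fin virt_mono.
Qed.

Lemma mean_law_support : law_support mean_law `<=` [set x | 0 <= x].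
Proof.
move=> x Gx /=; rewrite leNgt; apply/negP => x0.
have nx0 : 0 < - x by rewrite oppr_gt0.
have := Gx _ nx0; rewrite mean_lawE (_ : _ @^-1` _ = set0) ?measure0 ?ltxx//.
rewrite -subset0 => v /=; rewrite /ball/= => /ltr_distlCDr.
by rewrite subrr ltNge scaled_mean_ge0.
Qed.

End Transform.

Local Open Scope ereal_scope.

Theorem lemma3p1 (R : realType) (F : law R) (f : R -> R) (gamma : R)
    (hF : valuation_law F f)
    (hmean : F.-integrable setT (EFin : R -> \bar R))
    (hgamma : (1 <= gamma)%R) :
  exists (G : law R) (g : R -> R),
    [/\ valuation_law G g, regular G g &
        forall p : R, (0 < p)%R ->
          um_purchase_prob G p = vm_purchase_prob F gamma p /\
          um_revenue G p = vm_revenue F gamma p].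
Proof.
case: hF => F_cont [mf f0 fE] F_nneg.
have F_atomless (x : R) : F [set x] = 0%E by rewrite fE// integral_set1.
have gamma_gt0 : (0 < gamma)%R by exact: lt_le_trans hgamma.
pose G := mean_law F_cont F_atomless F_nneg hmean gamma_gt0.
have GE p : (0 < p)%R -> um_purchase_prob G p = vm_purchase_prob F gamma p.
  by move=> p0; rewrite (vm_purchase_mean F_cont F_atomless F_nneg hmean
    gamma_gt0 p0).
exists G, (mean_density F gamma); split.
- split.
  + exact/atomless_cdf_continuous/mean_law_atomless.
  + exact: mean_law_has_density.
  + exact: mean_law_support.
- exact: mean_law_regular.
- by move=> p p0; rewrite /um_revenue /vm_revenue GE.
Qed.
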